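(* Let $G$ be a cubic (i.e. $3$-regular) graph on $n$ vertices. If $G$ is not isomorphic to $K_4$, $3K_4$ or $K_{3,3}$, then $G$ contains a spanning subgraph $H$ such that for every integer $k$ with $0 \le k \le 3$, $$\left| m(H,k) - \frac{n}{4} \right| \le \frac{1}{2}.$$ If $G$ is isomorphic to $K_4$, $3K_4$ or $K_{3,3}$, then $G$ contains a spanning subgraph $H$ such that $$\max_{0\le k \le 3} \left|m(H,k) - \frac{n}{4}\right| \le \frac{3}{2}.$$
   Context: All graphs are finite and simple (no loops, no parallel edges); they are not assumed to be connected. A spanning subgraph of $G$ is a subgraph with the same vertex set as $G$. For a graph $H$ and a nonnegative integer $k$, $m(H,k)$ denotes the number of vertices of degree $k$ in $H$. $K_4$ is the complete graph on $4$ vertices, $K_{3,3}$ the complete bipartite graph with parts of size $3$ and $3$, and $3K_4$ the disjoint union of three copies of $K_4$. *)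

(* Defs.v *)
From mathcomp Require Import all_boot all_order all_algebra.

Set Implicit Arguments.
Unset Strict Implicit.
Unset Printing Implicit Defensive.

Record sgraph (T : finType) := SGraph {
  adj : rel T;
  adj_sym : symmetric adj;
  adj_irr : irreflexive adj
}.

Definition degree (T : finType) (G : sgraph T) (v : T) : nat :=
  #|[set w | adj G v w]|.

Definition cubic (T : finType) (G : sgraph T) : Prop :=
  forall v, degree G v = 3.

(* The vertex set of both graphs is all of T. *)
Definition spanning_subgraph (T : finType) (H G : sgraph T) : Prop :=
  forall x y, adj H x y -> adj G x y.

Definition isomorphic (T U : finType) (G : sgraph T) (H : sgraph U) : Prop :=
  exists2 f : T -> U, bijective f & forall x y, adj H (f x) (f y) = adj G x y.

(* m(H, k) *)
Definition mdeg (T : finType) (H : sgraph T) (k : nat) : nat :=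
  #|[set v | degree H v == k]|.

Definition complete_rel (T : finType) : rel T := fun x y => x != y.

Lemma complete_rel_sym (T : finType) : symmetric (@complete_rel T).
Proof. by move=> x y; rewrite /complete_rel eq_sym. Qed.

Lemma complete_rel_irr (T : finType) : irreflexive (@complete_rel T).
Proof. by move=> x; rewrite /complete_rel eqxx. Qed.

Definition complete (n : nat) : sgraph 'I_n :=
  SGraph (@complete_rel_sym 'I_n) (@complete_rel_irr 'I_n).

(* The two parts are the two summands of the vertex type. *)
Definition complete_bip_rel (T U : finType) : rel (T + U) := fun x y =>
  match x, y with
  | inl _, inr _ | inr _, inl _ => true
  | _, _ => false
  end.

Lemma complete_bip_rel_sym (T U : finType) : symmetric (@complete_bip_rel T U).
Proof. by case=> x [] y. Qed.

Lemma complete_bip_rel_irr (T U : finType) :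
  irreflexive (@complete_bip_rel T U).
Proof. by case. Qed.

Definition complete_bip (m n : nat) : sgraph ('I_m + 'I_n)%type :=
  SGraph (@complete_bip_rel_sym 'I_m 'I_n) (@complete_bip_rel_irr 'I_m 'I_n).

(* The first component of a vertex is the index of its copy. *)
Definition copies_rel (c : nat) (T : finType) (G : sgraph T) : rel ('I_c * T) :=
  fun x y => (x.1 == y.1) && adj G x.2 y.2.

Lemma copies_rel_sym (c : nat) (T : finType) (G : sgraph T) :
  symmetric (@copies_rel c T G).
Proof. by move=> x y; rewrite /copies_rel eq_sym adj_sym. Qed.

Lemma copies_rel_irr (c : nat) (T : finType) (G : sgraph T) :
  irreflexive (@copies_rel c T G).
Proof. by move=> x; rewrite /copies_rel adj_irr andbF. Qed.

Definition copies (c : nat) (T : finType) (G : sgraph T) :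
    sgraph ('I_c * T)%type :=
  SGraph (@copies_rel_sym c T G) (@copies_rel_irr c T G).

Definition exceptional (T : finType) (G : sgraph T) : Prop :=
  [\/ isomorphic G (complete 4),
      isomorphic G (copies 3 (complete 4)) |
      isomorphic G (complete_bip 3 3)].

(* Main.v *)
Require Import Defs.
From mathcomp Require Import all_boot all_order all_algebra.
From mathcomp Require Import zify lra.

Set Implicit Arguments.
Unset Strict Implicit.
Unset Printing Implicit Defensive.

(** Write [m k] for the number of vertices of degree [k] in [H]. For [n = 4q],
[H] is balanced iff all [m k] equal [q]; for [n = 4q + 2] it is enough, up to
complementing [H] inside [G], to get [(q+1, q, q+1, q)]. We start from a set [B]
with few neighbours and all edges meeting it, which makes [m 0] and [m 3] large,
and then flip a bounded number of edges at a time. First the number [m 0 + m 2]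
of even vertices is corrected while [m 0] and [m 3] stay large; then
[m 0 - m 2] and [m 3 - m 1], both nonnegative, are decreased to zero. Which
flips are available is decided by counting the edges on and off [H] according to
the degrees of their ends; the graphs on which every flip is blocked are exactly
the exceptional ones. *)

(** * Flipping edges *)

(** A vertex of degree 0, 1 or 2 in [H] has 3, 2 or 1 edges of [G] off [H]. If degree 0 outnumbers
    degree 2, the vertices of degree 2 cannot absorb all off-edges at degree 0, so off-edges 0-0 or
    0-1 exist; complementation gives the dual fact for degrees 3 and 1. This is why [m 0] and [m 3]
    are made large first. A blocked flip is an equation [npairs ... = 0]; added to the linear system
    [npairs_eqs], it forces edges of some other type, and [lia] finds them. Each surgery is then
    checked by computation on a short list of degrees. *)

Section Flip.
Variable T : finType.
Implicit Types (H : sgraph T) (u v x y : T).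

Definition flip_rel H u v : rel T := fun x y =>
  adj H x y (+) ((u != v) && ((x == u) && (y == v) || (x == v) && (y == u))).

Lemma flip_rel_sym H u v : symmetric (flip_rel H u v).
Proof.
move=> x y; rewrite /flip_rel (adj_sym H).
by case: (x == u) (x == v) (y == u) (y == v) => [] [] [] [].
Qed.

Lemma flip_rel_irr H u v : irreflexive (flip_rel H u v).
Proof.
move=> x; rewrite /flip_rel adj_irr /=; apply/negP => /andP[/eqP uv].
by case/orP => /andP[/eqP e1 /eqP e2]; case: uv; rewrite -e1 -e2.
Qed.

Definition flip H u v : sgraph T :=
  SGraph (flip_rel_sym H u v) (flip_rel_irr H u v).

Lemma degree_flip H u v x : u != v ->
  degree (flip H u v) x =
    if (x == u) || (x == v)
    then if adj H u v then (degree H x).-1 else (degree H x).+1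
    else degree H x.
Proof.
have end1 a b : a != b ->
    [set w | flip_rel H a b a w] =
      if adj H a b then [set w | adj H a w] :\ b else b |: [set w | adj H a w].
  move=> ab; apply/setP => w; rewrite !inE /flip_rel ab eqxx (negPf ab) /= orbF.
  case: (adj H a b) / idP => hab; rewrite !inE; case: eqP => [->|_].
  - by rewrite hab.
  - by rewrite addbF.
  - by move/negP/negPf: hab => ->.
  - by rewrite addbF.
have card1 a b : a != b -> #|[set w | flip_rel H a b a w]| =
    if adj H a b then (degree H a).-1 else (degree H a).+1.
  move=> ab; rewrite end1 // /degree; case: ifP => hab.
    by rewrite [in RHS](cardsD1 b) inE hab.
  by rewrite cardsU1 inE hab.
move=> uv; rewrite /degree -/(degree H x) /=.
have [->|xu] := eqVneq x u; first exact: card1.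
have [->|xv] /= := eqVneq x v.
  rewrite -[adj H u v]adj_sym -card1 1?eq_sym //; apply: eq_card => w.
  by rewrite !inE /flip_rel (eq_sym v u) orbC.
by apply: eq_card => w; rewrite !inE /flip_rel (negPf xu) (negPf xv) andbF addbF.
Qed.

(** Only vertices of [vs] can enter or leave a degree class. Sums on both sides avoid truncated
    subtraction. *)
Lemma mdeg_change H H' (vs : seq T) k : uniq vs ->
    (forall x, x \notin vs -> degree H' x = degree H x) ->
  mdeg H' k + count_mem k [seq degree H x | x <- vs] =
  mdeg H k + count_mem k [seq degree H' x | x <- vs].
Proof.
move=> uvs same.
have split K : mdeg K k =
    #|[set x | (x \notin vs) && (degree K x == k)]|
    + count_mem k [seq degree K x | x <- vs].
  rewrite /mdeg -(cardsID [set x in vs]) addnC; congr (_ + _).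
    by apply: eq_card => x; rewrite !inE.
  rewrite count_map -size_filter -(card_uniqP (filter_uniq _ uvs)).
  by apply: eq_card => x; rewrite !inE mem_filter andbC.
rewrite (split H) (split H') -!addnA [X in _ + X]addnC; congr (_ + _).
apply: eq_card => x; rewrite !inE; case: (boolP (x \in vs)) => //= xvs.
by rewrite same.
Qed.

End Flip.

(** * Sequences of flips on a list of named vertices *)

Definition bump (i : nat) (b : bool) (ds : seq nat) : seq nat :=
  set_nth 0 ds i (if b then (nth 0 ds i).-1 else (nth 0 ds i).+1).

Fixpoint play (es : seq (nat * nat * bool)) (ds : seq nat) : seq nat :=
  if es is (i, j, b) :: es' then play es' (bump j b (bump i b ds)) else ds.

Section Adjustments.
Variables (T : finType) (G : sgraph T).
Hypothesis cubG : cubic G.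
Implicit Types (H : sgraph T) (x y z : T).

Definition attains (a b c d : nat) : Prop :=
  exists2 H : sgraph T, spanning_subgraph H G &
    [/\ mdeg H 0 = a, mdeg H 1 = b, mdeg H 2 = c & mdeg H 3 = d].

(** The condition [i < j] gives each edge a single code. Distinct codes are then distinct edges when
    [vs] has no repetition, so a status read in the initial [H] is still right when its flip is
    made. *)
Definition playable H (x0 : T) (vs : seq T) (es : seq (nat * nat * bool)) :=
  uniq [seq e.1 | e <- es] &&
  all (fun e => [&& e.1.1 < e.1.2, e.1.2 < size vs,
                    adj G (nth x0 vs e.1.1) (nth x0 vs e.1.2) &
                    adj H (nth x0 vs e.1.1) (nth x0 vs e.1.2) == e.2]) es.

Lemma playP H x0 vs es :
    spanning_subgraph H G -> uniq vs -> playable H x0 vs es ->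
  exists2 H', spanning_subgraph H' G &
    (forall x, x \notin vs -> degree H' x = degree H x) /\
    [seq degree H' x | x <- vs] = play es [seq degree H x | x <- vs].
Proof.
move=> + uvs; elim: es H => [|[[i j] b] es IH] H sH /=; first by exists H.
rewrite /playable /= -/(playable _ _ _ _) => /andP[/andP[nij ues]].
move=> /andP[/and4P[ij jvs gij /eqP hij]] valid.
have ivs := ltn_trans ij jvs.
set u := nth x0 vs i in gij hij; set v := nth x0 vs j in gij hij.
have uv : u != v by rewrite nth_uniq // neq_ltn ij.
have [||H' sH' [same eqd]] := IH (flip H u v).
- move=> x y; rewrite /= /flip_rel uv /=; case hxy: (adj H x y) => /=.
    by move=> _; apply: sH.
  by case/orP => /andP[/eqP-> /eqP->] //; rewrite adj_sym.
- apply/andP; split=> //; apply/allP => -[[k l] c] kl.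
  move/allP/(_ _ kl): (valid) => /= /and4P[lk lvs -> /eqP <-].
  rewrite lk lvs /= /flip_rel uv /=.
  have kvs := ltn_trans lk lvs.
  rewrite !nth_uniq //.
  have -> : (k == j) && (l == i) = false.
    by apply/negP => /andP[/eqP ? /eqP ?]; lia.
  rewrite orbF; case: andP => [[/eqP e1 /eqP e2]|_]; last by rewrite addbF.
  by case/negP: nij; apply/mapP; exists (k, l, c); rewrite // e1 e2.
exists H' => //; split.
  move=> x xvs; rewrite same // degree_flip //.
  by case: ifP => // /orP[] /eqP e; rewrite e mem_nth in xvs.
rewrite eqd; congr (play _ _).
apply: (@eq_from_nth _ 0).
  by rewrite /bump !size_set_nth !size_map; lia.
move=> k; rewrite size_map => kvs.
rewrite /bump !nth_set_nth /= !nth_set_nth /= !(nth_map x0) // degree_flip //.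
rewrite /u /v !nth_uniq // hij.
case: (eqVneq k j) => [->|kj]; rewrite ?orbT ?orbF.
  by rewrite (gtn_eqF ij).
by case: eqP => [->|].
Qed.

Lemma local_adjust H x0 vs es ds :
    spanning_subgraph H G -> [seq degree H x | x <- vs] = ds ->
    uniq vs -> playable H x0 vs es ->
  exists a b c d, attains a b c d /\
    [/\ a + count_mem 0 ds = mdeg H 0 + count_mem 0 (play es ds),
        b + count_mem 1 ds = mdeg H 1 + count_mem 1 (play es ds),
        c + count_mem 2 ds = mdeg H 2 + count_mem 2 (play es ds) &
        d + count_mem 3 ds = mdeg H 3 + count_mem 3 (play es ds)].
Proof.
move=> sH <- uvs /playP[] // H' sH' [same <-].
exists (mdeg H' 0), (mdeg H' 1), (mdeg H' 2), (mdeg H' 3).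
by split; [exists H' | split; apply: mdeg_change].
Qed.

Lemma attains_eq a b c d a' b' c' d' :
  attains a b c d -> a = a' -> b = b' -> c = c' -> d = d' -> attains a' b' c' d'.
Proof. by move=> h <- <- <- <-. Qed.

(* [npairs H b i j] counts ordered pairs, so an edge with both ends of degree i
   is counted twice in [npairs H b i i]. *)
Definition npairs H (b : bool) (i j : nat) : nat :=
  \sum_x \sum_y [&& degree H x == i, degree H y == j,
                    adj G x y & adj H x y == b].

Lemma npairs_sym H b i j : npairs H b i j = npairs H b j i.
Proof.
rewrite /npairs exchange_big; apply: eq_bigr => x _; apply: eq_bigr => y _.
by rewrite andbCA (adj_sym G) (adj_sym H).
Qed.

(** An edge of [G] with its status in [H], packed so that destructing it gives the context all that
    [adjust] looks up. *)
Definition linked H b x y : Prop :=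
  [/\ x <> y, adj G x y = true, adj H x y = b & adj H y x = b].

Lemma linkedP H b x y : adj G x y -> adj H x y = b -> linked H b x y.
Proof.
move=> gxy hxy; split=> //; last by rewrite adj_sym.
by move=> e; rewrite e adj_irr in gxy.
Qed.

Lemma linked_sym H b x y : linked H b x y -> linked H b y x.
Proof. by case=> /nesym ? ? ? ?; split; rewrite // adj_sym. Qed.

Lemma npairs_gt0 H b i j : 0 < npairs H b i j ->
  exists x y, [/\ degree H x = i, degree H y = j & linked H b x y].
Proof.
rewrite /npairs lt0n sum_nat_eq0 => /forallPn[x].
rewrite sum_nat_eq0 => /forallPn[y].
rewrite eqb0 negbK => /and4P[/eqP dx /eqP dy gxy /eqP hxy].
by exists x, y; split=> //; apply: linkedP.
Qed.

Lemma linked_npairs H b x y :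
  linked H b x y -> 0 < npairs H b (degree H x) (degree H y).
Proof.
case=> _ gxy hxy _; rewrite /npairs (bigD1 x) //= (bigD1 y) //=.
by rewrite !eqxx gxy hxy eqxx.
Qed.

Lemma sum_bool_card (P : pred T) : \sum_x (P x : nat) = #|[set x | P x]|.
Proof.
by rewrite -sum1dep_card [RHS]big_mkcond; apply: eq_bigr => x _; case: (P x).
Qed.

(** * Counting edges on and off [H] by the degrees of their ends *)

Section Spanning.
Variable H : sgraph T.
Hypothesis sH : spanning_subgraph H G.

Definition nbd (b : bool) x : {set T} := [set y | adj G x y & adj H x y == b].

Lemma card_nbd b x : #|nbd b x| = if b then degree H x else 3 - degree H x.
Proof.
case: b; first by apply: eq_card => y; rewrite !inE; case h: (adj H x y);
  rewrite ?andbF // (sH h).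
rewrite -(cubG x) /degree -(cardsID [set y | adj H x y] [set y | adj G x y]).
have -> : [set y | adj G x y] :&: [set y | adj H x y] = [set y | adj H x y].
  apply/setP => y; rewrite !inE; case h: (adj H x y); rewrite ?andbF //.
  by rewrite (sH h).
rewrite addKn; apply: eq_card => y; rewrite !inE.
by case: (adj H x y); rewrite ?andbF ?andbT.
Qed.

Lemma degree_le3 x : degree H x <= 3.
Proof.
rewrite -(cubG x) /degree subset_leq_card //; apply/subsetP => y.
by rewrite !inE; apply: sH.
Qed.

Lemma npairs_row b i :
  npairs H b i 0 + npairs H b i 1 + npairs H b i 2 + npairs H b i 3 =
  mdeg H i * (if b then i else 3 - i).
Proof.
rewrite /npairs -!big_split /= /mdeg -sum_bool_card big_distrl /=.
apply: eq_bigr => x _; case: (eqVneq (degree H x) i) => [<-|_] /=; last first.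
  by rewrite !big1.
rewrite -!big_split /= mul1n -(card_nbd b x) -sum_bool_card.
apply: eq_bigr => y _; case: (adj G x y) => //=; rewrite ?andbF //.
by have := degree_le3 y; case: (degree H y) => [|[|[|[|]]]] //= _; case: (_ == b).
Qed.

Lemma mdeg_sum : mdeg H 0 + mdeg H 1 + mdeg H 2 + mdeg H 3 = #|T|.
Proof.
rewrite /mdeg -!sum_bool_card -!big_split /= -sum1_card; apply: eq_bigr => x _.
by have := degree_le3 x; case: (degree H x) => [|[|[|[|]]]].
Qed.

(** The rows of [npairs_row], with symmetric terms identified. Off-edges at degree 3 and on-edges at
    degree 0 disappear because their rows sum to zero. *)
Lemma npairs_eqs (o := npairs H false) (p := npairs H true) :
  [/\ [/\ mdeg H 0 * 3 = o 0 0 + o 0 1 + o 0 2,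
          mdeg H 1 * 2 = o 0 1 + o 1 1 + o 1 2 &
          mdeg H 2 = o 0 2 + o 1 2 + o 2 2],
      [/\ mdeg H 1 = p 1 1 + p 1 2 + p 1 3,
          mdeg H 2 * 2 = p 1 2 + p 2 2 + p 2 3 &
          mdeg H 3 * 3 = p 1 3 + p 2 3 + p 3 3] &
      mdeg H 0 + mdeg H 1 + mdeg H 2 + mdeg H 3 = #|T|].
Proof.
have o0 := npairs_row false 0; have o1 := npairs_row false 1.
have o2 := npairs_row false 2; have o3 := npairs_row false 3.
have p0 := npairs_row true 0; have p1 := npairs_row true 1.
have p2 := npairs_row true 2; have p3 := npairs_row true 3.
have sym b i j := npairs_sym H b i j.
have s := mdeg_sum; rewrite {}/o {}/p /=.
move: o0 o1 o2 o3 p0 p1 p2 p3; rewrite /= !muln0.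
rewrite !(sym _ 1 0) !(sym _ 2 0) !(sym _ 2 1).
rewrite !(sym _ 3 0) !(sym _ 3 1) !(sym _ 3 2) => *.
by split; [split; lia|split; lia|exact: s].
Qed.

Lemma off_other i x y : degree H x = i -> i <= 1 ->
  exists2 z, z <> y & linked H false x z.
Proof.
move=> <- dx; have := card_nbd false x => /= c.
have : 0 < #|nbd false x :\ y| by have := cardsD1 y (nbd false x); lia.
case/card_gt0P => z; rewrite !inE => /and3P[/eqP zy gz /eqP hz].
by exists z => //; apply: linkedP.
Qed.

Lemma off_nbr i x : degree H x = i -> i <= 2 -> exists z, linked H false x z.
Proof.
move=> <- dx; have := card_nbd false x => /= c.
have : 0 < #|nbd false x| by lia.
case/card_gt0P => z; rewrite !inE => /andP[gz /eqP hz].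
by exists z; apply: linkedP.
Qed.

Lemma on_other i x y : degree H x = i -> 2 <= i ->
  exists2 z, z <> y & linked H true x z.
Proof.
move=> <- dx; have := card_nbd true x => /= c.
have : 0 < #|nbd true x :\ y| by have := cardsD1 y (nbd true x); lia.
case/card_gt0P => z; rewrite !inE => /and3P[/eqP zy gz /eqP hz].
by exists z => //; apply: linkedP.
Qed.

Lemma on_nbr i x : degree H x = i -> 1 <= i -> exists z, linked H true x z.
Proof.
move=> <- dx; have := card_nbd true x => /= c.
have : 0 < #|nbd true x| by lia.
case/card_gt0P => z; rewrite !inE => /andP[gz /eqP hz].
by exists z; apply: linkedP.
Qed.

(** Pigeonhole: with at most one such neighbour for each vertex of degree [j], there would be at
    most [mdeg H j] pairs. *)
Lemma npairs_cherry b i j : mdeg H j < npairs H b i j ->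
  exists w x y, [/\ degree H w = j, degree H x = i, degree H y = i, x <> y &
    linked H b w x /\ linked H b w y].
Proof.
rewrite npairs_sym => lt.
pose nb w := [set y | [&& degree H y == i, adj G w y & adj H w y == b]].
have [/existsP[w /andP[/eqP dw /card_gt1P[x [y []]]]]|none] :=
    boolP [exists w, (degree H w == j) && (1 < #|nb w|)].
  rewrite !inE => /and3P[/eqP dx gx /eqP hx] /and3P[/eqP dy gy /eqP hy] /eqP xy.
  by exists w, x, y; do 2?split=> //; apply: linkedP.
suff: npairs H b j i <= mdeg H j by rewrite leqNgt lt.
rewrite /npairs /mdeg -sum_bool_card; apply: leq_sum => w _.
case: (eqVneq (degree H w) j) => dw /=; last by rewrite big1.
rewrite sum_bool_card leqNgt; apply: contra none => c.
by apply/existsP; exists w; rewrite dw eqxx.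
Qed.

(** The end [y] has an off-edge, so its degree is not 3. Positivity is returned in both orders so
    that it clashes directly with a vanishing [npairs], whichever order that uses. *)
Lemma off_cases i x y : degree H x = i -> linked H false x y ->
  [\/ degree H y = 0 /\ 0 < npairs H false i 0 /\ 0 < npairs H false 0 i,
      degree H y = 1 /\ 0 < npairs H false i 1 /\ 0 < npairs H false 1 i |
      degree H y = 2 /\ 0 < npairs H false i 2 /\ 0 < npairs H false 2 i].
Proof.
move=> <- lxy; have := linked_npairs lxy; have := degree_le3 y.
have : degree H y != 3.
  apply/eqP => dy; have := card_nbd false y => /=; rewrite dy => /eqP.
  rewrite cards_eq0 => /eqP/setP/(_ x); rewrite !inE.
  by case: lxy => _; rewrite (adj_sym G) => -> _ ->.
rewrite ![npairs H false _ (degree H x)]npairs_sym.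
by case: (degree H y) => [|[|[|[|]]]] // _ _ ?;
  [constructor 1|constructor 2|constructor 3].
Qed.

Lemma on_cases i x y : degree H x = i -> linked H true x y ->
  [\/ degree H y = 1 /\ 0 < npairs H true i 1 /\ 0 < npairs H true 1 i,
      degree H y = 2 /\ 0 < npairs H true i 2 /\ 0 < npairs H true 2 i |
      degree H y = 3 /\ 0 < npairs H true i 3 /\ 0 < npairs H true 3 i].
Proof.
move=> <- lxy; have := linked_npairs lxy; have := degree_le3 y.
have : degree H y != 0.
  apply/eqP => dy; have := card_nbd true y => /=; rewrite dy => /eqP.
  rewrite cards_eq0 => /eqP/setP/(_ x); rewrite !inE.
  by case: lxy => _; rewrite (adj_sym G) => -> _ ->.
rewrite ![npairs H true _ (degree H x)]npairs_sym.
by case: (degree H y) => [|[|[|[|]]]] // _ _ ?;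
  [constructor 1|constructor 2|constructor 3].
Qed.

Lemma mdeg_avoid (s : seq T) k : size s < mdeg H k ->
  exists2 x, x \notin s & degree H x = k.
Proof.
move=> lt; have : 0 < #|[set x | degree H x == k] :\: [set x in s]|.
  have := cardsID [set x in s] [set x | degree H x == k].
  have : #|[set x | degree H x == k] :&: [set x in s]| <= size s.
    apply: leq_trans (card_size s); rewrite subset_leq_card //.
    by apply/subsetP => x; rewrite !inE => /andP[].
  by move: lt; rewrite /mdeg; lia.
by case/card_gt0P => x; rewrite !inE => /andP[xs /eqP dx]; exists x.
Qed.

Lemma mdeg_ge (s : seq T) k :
    uniq s -> [seq degree H x | x <- s] = nseq (size s) k ->
  size s <= mdeg H k.
Proof.
move=> us ds; rewrite -(card_uniqP us) subset_leq_card //.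
apply/subsetP => x xs; rewrite inE.
have : degree H x \in nseq (size s) k by rewrite -ds map_f.
by case/nseqP => ->.
Qed.

End Spanning.

(** Complementing [H] inside the cubic [G] turns degree [k] into [3 - k]. *)
Lemma attains_compl a b c d : attains a b c d -> attains d c b a.
Proof.
case=> H sH [E0 E1 E2 E3].
pose r x y := adj G x y && ~~ adj H x y.
have rs : symmetric r by move=> x y; rewrite /r (adj_sym G) (adj_sym H).
have ri : irreflexive r by move=> x; rewrite /r adj_irr.
have dr x : degree (SGraph rs ri) x = 3 - degree H x.
  rewrite -(card_nbd sH false); apply: eq_card => y; rewrite !inE /= /r.
  by case: (adj H x y).
exists (SGraph rs ri); first by move=> x y /andP[].
by rewrite -E0 -E1 -E2 -E3; split; apply: eq_card => x; rewrite !inE dr;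
  have := degree_le3 sH x; case: (degree H x) => [|[|[|[|]]]].
Qed.

End Adjustments.

(** * Recognizing the exceptional graphs *)

Section Recognition.
Variables (T : finType) (G : sgraph T).
Hypothesis cubG : cubic G.
Implicit Types x y : T.

Lemma card_adj x : #|[set y | adj G x y]| = 3.
Proof. exact: cubG. Qed.

Lemma index_enum_lt (A : {set T}) x k :
  #|A| = k.+1 -> x \in A -> index x (enum A) < k.+1.
Proof. by move=> cA xA; rewrite -cA cardE index_mem mem_enum. Qed.

Lemma inord_index_inj (A : {set T}) k : #|A| = k.+1 ->
  {in A &, injective (fun x => inord (index x (enum A)) : 'I_k.+1)}.
Proof.
move=> cA x y xA yA /(congr1 val) /=; rewrite !inordK ?index_enum_lt // => e.
have xe : x \in enum A by rewrite mem_enum.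
have ye : y \in enum A by rewrite mem_enum.
by rewrite -(nth_index x xe) e nth_index.
Qed.

(** A neighbourhood lies in the opposite class and both have three elements, so they coincide. *)
Lemma iso_complete_bip (s : pred T) :
    #|[set x | s x]| = 3 -> #|[set x | ~~ s x]| = 3 ->
    (forall x y, adj G x y -> s x != s y) ->
  isomorphic G (complete_bip 3 3).
Proof.
move=> c1 c2 cross.
have adjE x y : adj G x y = (s x != s y).
  have sub : [set z | adj G x z] \subset [set z | s x != s z].
    by apply/subsetP => z; rewrite !inE; apply: cross.
  have : [set z | adj G x z] == [set z | s x != s z].
    rewrite eqEcard sub card_adj.
    have -> : [set z | s x != s z] =
        if s x then [set z | ~~ s z] else [set z | s z].
      by apply/setP => z; case: (s x); rewrite !inE; case: (s z).
    by case: (s x); rewrite ?c1 ?c2.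
  by move/eqP/setP/(_ y); rewrite !inE.
pose f x : 'I_3 + 'I_3 :=
  if s x then inl (inord (index x (enum [set x | s x])))
  else inr (inord (index x (enum [set x | ~~ s x]))).
exists f; last first.
  by move=> x y; rewrite adjE /f; case: (s x) (s y) => [] [].
apply: inj_card_bij; last first.
  by rewrite card_sum !card_ord -(cardC s) -(cardsE s) c1 -(cardsE [predC s]) c2.
move=> x y; rewrite /f; case sx: (s x); case sy: (s y) => // -[].
  by apply: (inord_index_inj c1); rewrite inE.
by apply: (inord_index_inj c2); rewrite inE ?sx ?sy.
Qed.

Lemma iso_copies_complete (c : T -> 'I_3) :
    (forall k, #|[set x | c x == k]| = 4) ->
    (forall x y, adj G x y -> c x = c y) ->
  isomorphic G (copies 3 (complete 4)).
Proof.
move=> c4 closed.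
have adjE x y : adj G x y = (c x == c y) && (x != y).
  have : [set z | adj G x z] == [set z | c z == c x] :\ x.
    rewrite eqEcard card_adj; apply/andP; split.
      apply/subsetP => z; rewrite !inE => xz; rewrite (closed _ _ xz) eqxx andbT.
      by apply: contraTneq xz => ->; rewrite adj_irr.
    by have := cardsD1 x [set z | c z == c x]; rewrite c4 inE eqxx => /eqP; lia.
  by move/eqP/setP/(_ y); rewrite !inE eq_sym andbC [c y == _]eq_sym.
pose f x := (c x, inord (index x (enum [set y | c y == c x])) : 'I_4).
have f_inj : injective f.
  move=> x y [cxy]; rewrite cxy.
  by apply: (inord_index_inj (c4 _)); rewrite inE ?cxy.
exists f.
  apply: inj_card_bij => //; rewrite card_prod !card_ord -sum1_card.
  rewrite (partition_big c predT) //= (eq_bigr (fun=> 4)) => [|k _].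
    by rewrite sum_nat_const card_ord.
  by rewrite sum1dep_card c4.
move=> x y; rewrite adjE -(inj_eq f_inj) /= /copies_rel /complete_rel /=.
by rewrite xpair_eqE; case: (c x == c y).
Qed.

Lemma iso_three_closed (A B : {set T}) :
    #|T| = 12 -> #|A| = 4 -> #|B| = 4 -> [disjoint A & B] ->
    (forall x y, adj G x y -> x \in A -> y \in A) ->
    (forall x y, adj G x y -> x \in B -> y \in B) ->
  isomorphic G (copies 3 (complete 4)).
Proof.
move=> n cA cB dAB clA clB.
pose c x : 'I_3 :=
  if x \in A then inord 0 else if x \in B then inord 1 else inord 2.
have closed (C : {set T}) (cl : forall x y, adj G x y -> x \in C -> y \in C)
    x y :
    adj G x y -> (x \in C) = (y \in C).
  by move=> xy; apply/idP/idP; apply: cl; rewrite // adj_sym.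
apply: (@iso_copies_complete c) => [k|x y xy]; last first.
  by rewrite /c (closed A clA _ _ xy) (closed B clB _ _ xy).
have notB x : x \in A -> x \notin B by move=> xA; rewrite (disjointFr dAB xA).
have cAB := cardsUI A B; move: dAB; rewrite -setI_eq0 => /eqP AB0.
rewrite AB0 cards0 cA cB in cAB.
have cC := cardsC (A :|: B); rewrite n in cC.
have ceq x : (c x == k) = if x \in A then k == 0 :> nat
    else if x \in B then k == 1 :> nat else k == 2 :> nat.
  rewrite -val_eqE /c.
  by case: (x \in A); [|case: (x \in B)]; rewrite /= inordK // eq_sym.
case: k ceq => -[|[|[|//]]] /= lt3 ceq.
- rewrite -cA; apply: eq_card => x; rewrite !inE ceq.
  by case: (x \in A); case: (x \in B).
- rewrite -cB; apply: eq_card => x; rewrite !inE ceq.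
  by case: (boolP (x \in A)) => [/notB/negPf->|_] //; case: (x \in B).
rewrite (_ : [set x | _] = ~: (A :|: B)); first by lia.
by apply/setP => x; rewrite !inE ceq; case: (x \in A); case: (x \in B).
Qed.

Lemma iso_complete : #|T| = 4 -> isomorphic G (complete 4).
Proof.
move=> c4; have adjE x y : adj G x y = (x != y).
  have : [set z | adj G x z] == [set~ x].
    rewrite eqEcard card_adj cardsC1 c4 andbT.
    by apply/subsetP => z; rewrite !inE; apply: contraTneq => ->; rewrite adj_irr.
  by move/eqP/setP/(_ y); rewrite !inE eq_sym.
exists (fun x => cast_ord c4 (enum_rank x)).
  exists (fun k => enum_val (cast_ord (esym c4) k)) => x.
    by rewrite cast_ordK enum_rankK.
  by rewrite enum_valK cast_ordKV.
move=> x y; rewrite adjE /= /complete_rel.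
by rewrite (inj_eq (@cast_ord_inj _ _ _)) (inj_eq enum_rank_inj).
Qed.

End Recognition.

(** * Correcting the number of even vertices *)

Ltac rewrite_degrees :=
  repeat match goal with
  | h : degree _ ?x = _ |- context [degree _ ?x] => rewrite h
  end.

Ltac prove_distinct :=
  rewrite /= ?inE ?negb_or; repeat (apply/andP; split); try done;
  apply/eqP; congruence.

Ltac prove_playable :=
  rewrite /playable /=; repeat (apply/andP; split);
  first [done | assumption | apply/eqP; assumption
        | rewrite adj_sym; first [assumption | apply/eqP; assumption]].

(* [adjust sH vs es] flips the edges [es], given by positions in the list [vs]
   of distinct vertices together with their status in [H], and leaves in [hs]
   the degree counts of the new subgraph. *)
Ltac adjust sH vs es hs :=
  let U := fresh "U" in
  let P := fresh "P" in
  let x0 := match vs with ?x :: _ => x end in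
  (have U : uniq vs by prove_distinct);
  match type of sH with
  | spanning_subgraph ?H ?G => (have P : playable G H x0 vs es by prove_playable)
  end;
  case: (local_adjust sH (erefl _) U P) => ? [? [? [? [hs]]]];
  rewrite /= /bump /=; rewrite_degrees; rewrite /= => -[? ? ? ?];
  clear U P.

(* The boolean facts about adjacency only slow [lia] down. *)
Ltac count :=
  repeat match goal with
  | h : context [linked] |- _ => clear h
  | h : context [degree] |- _ => clear h
  | h : context [adj] |- _ => clear h
  end; lia.

Ltac clear_npairs :=
  repeat match goal with h : context [npairs] |- _ => clear h end.

Ltac npairs_absurd :=
  match goal with h : is_true (0 < ?n), e : ?n = 0 |- _ => by rewrite e in h end.

Ltac adjusted sH vs es :=
  let hs := fresh "hs" in
  adjust sH vs es hs; apply: (attains_eq hs); clear_npairs; count.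

Section EvenVertices.
Variables (T : finType) (G : sgraph T).
Hypothesis cubG : cubic G.

Lemma attains_sum a b c d : attains G a b c d -> a + b + c + d = #|T|.
Proof. by case=> H sH [<- <- <- <-]; apply: mdeg_sum cubG _ sH. Qed.

(** Removing a 2-2 on-edge gives the first outcome. If there is none, at least [c * 2 - b > d]
    on-edges join degree 2 to degree 3, so some vertex of degree 3 has two of them; removing both
    gives the second. *)
Lemma lower_twos a b c d : attains G a b c d -> b + d < c * 2 ->
  attains G a (b + 2) (c - 2) d \/ attains G a (b + 3) (c - 2) (d - 1).
Proof.
case=> H sH [E0 E1 E2 E3] lt.
case: (npairs_eqs cubG sH) => -[? ? ?] [? ? ?] _.
case: (posnP (npairs G H true 2 2)) => [?|/npairs_gt0[x [y [dx dy []]]]].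
  have [|w [x [y [dw dx dy xy [[? ? ? ?] [? ? ? ?]]]]]] :=
    @npairs_cherry T G H true 2 3.
    by count.
  by right; adjusted sH [:: w; x; y] [:: (0, 1, true); (0, 2, true)].
by move=> ????; left; adjusted sH [:: x; y] [:: (0, 1, true)].
Qed.

(** [e] is the number of even vertices; [i] and [j] are the floors kept under [m 0] and [m 3]. *)
Definition dominates (i j e : nat) : Prop :=
  exists a b c d, [/\ attains G a b c d, i <= a, j <= d & a + c = e].

Lemma dominates_of i j e a b c d :
  attains G a b c d -> i <= a -> j <= d -> a + c = e -> dominates i j e.
Proof. by move=> h ia jd ac; exists a, b, c, d. Qed.

(* The way out when [lower_even] is blocked: a better state, or [K_{3,3}]. *)
Definition special i j : Prop := j = i.+1 /\
  [\/ attains G i.+1 i i.+1 i, attains G i.+1 i.-1 i.+1 i.+1 |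
      [/\ i = 1, attains G 1 0 3 2 & isomorphic G (complete_bip 3 3)]].

(** Two even vertices must become odd without breaking the floors [i] and [j]. A surplus at degree 0
    or 3 gives room for that; only the tight case [a = i], [d = j] can fail. *)
Lemma lower_even i j a b c d e : attains G a b c d ->
    #|T| = (i + j) * 2 -> i <= j.+1 -> j <= i.+1 -> 0 < i ->
    i <= a -> j <= d -> a + c = e + 2 -> i * 2 <= e ->
  dominates i j e \/ special i j.
Proof.
move=> h n ij ji i0 ia jd ac ie; have sum := attains_sum h; rewrite n in sum.
(* [lower_twos] costs at most one vertex of degree 3, so one spare suffices. *)
have twos : j < d -> a <= i.+1 -> dominates i j e.
  move=> jd' ai; have [|h'|h'] := lower_twos h; first count;
    by apply: (dominates_of h'); lia.
(* Flipping a 1-2 off-edge first creates the spare vertex of degree 3. *)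
have twos' : j = d -> i <= a <= i.+1 -> attains G a b.-1 c d.+1 ->
    dominates i j e.
  move=> jd' ai h1; have sum1 := attains_sum h1.
  rewrite n in sum1; have [|h'|h'] := lower_twos h1; first count;
    by apply: (dominates_of h'); lia.
have [H sH [E0 E1 E2 E3]] := h.
case: (npairs_eqs cubG sH) => -[? ? ?] [? ? ?] _.
case: (posnP (npairs G H false 2 2)) => [?|/npairs_gt0[x [y [dx dy [? ? ? ?]]]]];
  last by left; adjust sH [:: x; y] [:: (0, 1, false)] hs;
          apply: (dominates_of hs); clear_npairs; count.
case: (posnP (npairs G H true 2 2)) => [?|/npairs_gt0[x [y [dx dy [? ? ? ?]]]]];
  last by left; adjust sH [:: x; y] [:: (0, 1, true)] hs;
          apply: (dominates_of hs); clear_npairs; count.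
have [ai|ia'] := leqP a i; last first.
  case: (posnP (npairs G H false 0 2)) => [?|/npairs_gt0[x [y [dx dy [? ? ? ?]]]]];
    last by left; adjust sH [:: x; y] [:: (0, 1, false)] hs;
            apply: (dominates_of hs); clear_npairs; count.
  have [ai'|ia''] := leqP a i.+1; last first.
    have /npairs_gt0[x [y [dx dy [? ? ? ?]]]] : 0 < npairs G H false 0 0 by count.
    left; adjust sH [:: x; y] [:: (0, 1, false)] hs.
    by apply: (dominates_of hs); clear_npairs; count.
  left; have [?|?] := leqP d j; last by apply: twos.
  have /npairs_gt0[x [y [dx dy [? ? ? ?]]]] : 0 < npairs G H false 1 2 by count.
  by apply: twos'; [count|count|]; adjusted sH [:: x; y] [:: (0, 1, false)].
have [?|?] := leqP d j; last by left; apply: twos; lia.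
case: (posnP (npairs G H false 1 2)) => [?|/npairs_gt0[x [y [dx dy [? ? ? ?]]]]];
  last by left; apply: twos'; [count|count|];
          adjusted sH [:: x; y] [:: (0, 1, false)].
have off2 x : degree H x = 2 -> exists2 z, degree H z = 0 & linked G H false x z.
  move=> dx; have [z lxz] := off_nbr cubG sH dx isT.
  exists z => //; have [] := off_cases cubG sH dx lxz => -[? [? ?]] //;
    npairs_absurd.
case: (posnP (npairs G H true 1 2)) => [?|/npairs_gt0[x [y [dx dy [? ? ? ?]]]]];
  last first.
  have [|y' + dy'] := @mdeg_avoid _ H [:: y] 2; first by rewrite /=; count.
  rewrite inE => /eqP ?; have [z dz [? ? ? ?]] := off2 y' dy'.
  left; adjust sH [:: x; y; z; y'] [:: (0, 1, true); (2, 3, false)] hs.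
  by apply: (dominates_of hs); clear_npairs; count.
case: (posnP (npairs G H true 1 1)) => [?|/npairs_gt0[x [x' [dx dx' [? ? ? ?]]]]];
  last first.
  have [|w [y1 [y2 [dw dy1 dy2 ? [[? ? ? ?] [? ? ? ?]]]]]] :=
    @npairs_cherry T G H true 2 3; first count.
  have [|y' + dy'] := @mdeg_avoid _ H [:: y1; y2] 2; first by rewrite /=; count.
  rewrite !inE => /norP[/eqP ? /eqP ?]; have [z dz [? ? ? ?]] := off2 y' dy'.
  left; adjust sH [:: x; x'; w; y1; y2; z; y']
    [:: (0, 1, true); (2, 3, true); (2, 4, true); (5, 6, false)] hs.
  by apply: (dominates_of hs); clear_npairs; count.
(* With on-edges 1-1, 1-2 and 2-2 excluded, counting at degree 3 gives [c * 2 + b <= d * 3].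
   Together with [b + c = i + j], [c >= i + 2] and [j <= i + 1] this is tight, so 3-3 on-edges are
   excluded too. *)
have [ej eb ec] : [/\ j = i.+1, b.+1 = i & c = i.+2] by split; lia.
right; split=> //.
case: (posnP (npairs G H true 1 3)) => [?|/npairs_gt0[x [w [dx dw [? ? ? ?]]]]].
  have i1 : i = 1 by count.
  constructor 3; split=> //; first by apply: (attains_eq h); lia.
  have m1 z : degree H z <> 1.
    move=> dz; have := @mdeg_ge _ H [:: z] 1 isT.
    by rewrite /= dz => /(_ erefl); lia.
  (* One side is the three vertices of degree 2, the other the vertex of degree 0 and the two of
     degree 3; the counts leave no edge inside either side. *)
  apply: (@iso_complete_bip T G cubG (fun x => degree H x == 2)).
  - by rewrite -/(mdeg H 2); lia.
  - have := cardsC [set x | degree H x == 2]; rewrite -/(mdeg H 2) n.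
    rewrite (_ : ~: _ = [set x | degree H x != 2]); first count.
    by apply/setP => x; rewrite !inE.
  move=> x y gxy.
  have [s lxy] : exists s, linked G H s x y by exists (adj H x y); apply: linkedP.
  case: s lxy => lxy.
    have [] := on_cases cubG sH erefl (linked_sym lxy) => -[dx _];
      have [] := on_cases cubG sH dx lxy => -[dy [? ?]];
      by [rewrite dx dy | case: (m1 x) | case: (m1 y) | count].
  have [] := off_cases cubG sH erefl (linked_sym lxy) => -[dx _];
    have [] := off_cases cubG sH dx lxy => -[dy [? ?]];
    by [rewrite dx dy | case: (m1 x) | case: (m1 y) | count].
have [v ? lwv] := on_other cubG sH x dw isT.
have [? ? ? ?] := lwv.
have [[dv _]|[dv _]|[dv [? _]]] := on_cases cubG sH dw lwv; last by count.
  have [|y _ dy] := @mdeg_avoid _ H [::] 2; first by rewrite /=; count.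
  have [z dz [? ? ? ?]] := off2 y dy.
  constructor 2; adjusted sH [:: w; x; v; z; y]
    [:: (0, 1, true); (0, 2, true); (3, 4, false)].
by constructor 1; adjusted sH [:: w; x; v] [:: (0, 1, true); (0, 2, true)].
Qed.

End EvenVertices.

(** * Orders divisible by four *)

Section UnitExcess.
Variables (T : finType) (G : sgraph T).
Hypothesis cubG : cubic G.

(** The unbalanced states where the descent stops are kept because they witness the weaker bound. *)
Definition three_K4 : Prop :=
  [/\ #|T| = 12, isomorphic G (copies 3 (complete 4)) &
      attains G 4 2 2 4 \/ attains G 4 3 2 3].

Lemma npairs_split H b i j : npairs G H b i j =
  #|[set e : T * T | [&& degree H e.1 == i, degree H e.2 == j,
                         adj G e.1 e.2 & adj H e.1 e.2 == b]]|.
Proof.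
by rewrite /npairs pair_big /= sum_bool_card.
Qed.

Lemma npairs_avoid H b i j x :
    #|nbd G H b x| < npairs G H b i j ->
  exists x' y',
    [/\ x' <> x, degree H x' = i, degree H y' = j & linked G H b x' y'].
Proof.
rewrite npairs_split => lt.
set P := [set e | _] in lt; pose A := [set e : T * T | e.1 == x].
have : 0 < #|P :\: A|.
  have := cardsID A P.
  have : #|P :&: A| <= #|nbd G H b x|.
    rewrite -(@card_in_imset _ _ snd).
      apply: subset_leq_card; apply/subsetP => y /imsetP[[u v]].
      by rewrite !inE /= => /andP[/and4P[_ _ g h] /eqP e] ->; rewrite -e g h.
    move=> [u v] [u' v'] /=; rewrite !inE /=.
    by move=> /andP[_ /eqP->] /andP[_ /eqP->] ->.
  lia.
case/card_gt0P => -[x' y']; rewrite !inE /=.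
case/andP => /eqP ? /and4P[/eqP ? /eqP ? ? /eqP ?].
by exists x', y'; split=> //; apply: linkedP.
Qed.

(** These edges form a bipartite graph. Without two disjoint edges it would be a star, hence have at
    most three edges. *)
Lemma disjoint_01_pairs H : spanning_subgraph H G -> 3 < npairs G H false 0 1 ->
  exists z p z' p',
    [/\ degree H z = 0, degree H p = 1, degree H z' = 0 & degree H p' = 1] /\
    [/\ z <> z', p <> p', linked G H false z p & linked G H false z' p'].
Proof.
move=> sH gt.
have /npairs_gt0[z [p [dz dp lzp]]] : 0 < npairs G H false 0 1 by lia.
have [|z2 [p2 [nz dz2 dp2 l2]]] := @npairs_avoid H false 0 1 z.
  by rewrite (card_nbd cubG sH) dz.
have [epp|npp] := eqVneq p2 p; last first.
  exists z, p, z2, p2; do 2!split=> //; first exact/nesym.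
  by apply/eqP; rewrite eq_sym.
have [|p3 [z3 [np dp3 dz3 l3]]] := @npairs_avoid H false 1 0 p.
  by rewrite (card_nbd cubG sH) dp npairs_sym; lia.
have l3' := linked_sym l3.
have [ezz|nzz] := eqVneq z3 z.
  exists z2, p2, z3, p3; do 2!split=> //; first by rewrite ezz.
  by rewrite epp; apply/nesym.
exists z, p, z3, p3; do 2!split=> //; last by apply/nesym.
by apply/nesym/eqP.
Qed.

(** A 0-0 and a 1-1 off-edge flipped together move two vertices from degree 0 to degree 2 in effect.
    Without 1-1 off-edges, degree 1 has [2q] off-edges, at most [q - 2] of them to degree 2, so at
    least four go to degree 0. *)
Lemma excess_two q c : #|T| = q * 4 -> q = c.+2 ->
  attains G q.+2 q c q -> attains G q q q q.
Proof.
move=> n qc h; have [H sH [E0 E1 E2 E3]] := h.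
case: (npairs_eqs cubG sH) => -[? ? ?] [? ? ?] _.
have /npairs_gt0[z [z' [dz dz' [? ? ? ?]]]] : 0 < npairs G H false 0 0 by lia.
case: (posnP (npairs G H false 1 1)) => [?|/npairs_gt0[p [p' [dp dp' [? ? ? ?]]]]];
  last by adjusted sH [:: z; z'; p; p'] [:: (0, 1, false); (2, 3, false)].
have [|z1 [p1 [z2 [p2 [[? ? ? ?] [? ? [? ? ? ?] [? ? ? ?]]]]]]] :=
  @disjoint_01_pairs H sH; first lia.
by adjusted sH [:: z1; p1; z2; p2] [:: (0, 1, false); (2, 3, false)].
Qed.

Lemma excess_one q c : #|T| = q * 4 -> q = c.+1 ->
  attains G q.+1 q c q -> attains G q q q q \/ three_K4.
Proof.
move=> n qc h; have [H sH [E0 E1 E2 E3]] := h.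
(* Moving away from balance also helps, since an excess of two can always be repaired. *)
have up : attains G q.+2 q c.-1 q -> attains G q q q q.
  move=> h'; have := attains_sum cubG h'; have := attains_sum cubG h => ? ?.
  by apply: excess_two h'; lia.
case: (npairs_eqs cubG sH) => -[? ? ?] [? ? ?] _.
case: (posnP (npairs G H false 0 1)) => [?|/npairs_gt0[z [p [dz dp [? ? ? ?]]]]];
  last by left; adjusted sH [:: z; p] [:: (0, 1, false)].
case: (posnP (npairs G H true 1 2)) => [?|/npairs_gt0[x [y [dx dy [? ? ? ?]]]]];
  last by left; apply: up; adjusted sH [:: x; y] [:: (0, 1, true)].
have /npairs_gt0[z [z' [dz dz' [? ? ? ?]]]] : 0 < npairs G H false 0 0 by count.
have /npairs_gt0[p [p' [dp dp' lpp']]] : 0 < npairs G H false 1 1 by count.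
(* A recurring trick: replacing the on-edge [x b] by the off-edge [x x'] keeps the degree of [x],
   lowers [b] and raises [x']. *)
have leaf x x' : degree H x = 1 -> degree H x' = 1 -> linked G H false x x' ->
    (exists2 w, degree H w = 3 & linked G H true x w) \/ attains G q q q q.
  move=> dx dx' [? ? ? ?]; have [b lxb] := on_nbr cubG sH dx isT.
  have [] := on_cases cubG sH dx lxb => -[db [? ?]];
    [|npairs_absurd|by left; exists b].
  have [? ? ? ?] := lxb; right; adjusted sH [:: x; b; x'; z; z']
    [:: (0, 1, true); (0, 2, false); (3, 4, false)].
have [[w dw lpw]|?] := leaf _ _ dp dp' lpp'; last by left.
have [[w' dw' lpw']|?] := leaf _ _ dp' dp (linked_sym lpp'); last by left.
have [? ? ? ?] := lpp'; have [? ? ? ?] := lpw.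
case: (posnP (npairs G H false 0 2)) => [?|/npairs_gt0[z2 [y [dz2 dy [? ? ? ?]]]]];
  last by left; adjusted sH [:: p; w; p'; z2; y]
    [:: (0, 1, true); (0, 2, false); (3, 4, false)].
case: (posnP (npairs G H false 1 2)) => [?|/npairs_gt0[x [y [dx dy [? ? ? ?]]]]].
  2: {
  have [l [v [dl dv [? ? ? ?] lx]]] : exists l v,
      [/\ degree H l = 1, degree H v = 3, linked G H true l v & l <> x].
    have [<-|/eqP ?] := eqVneq p x; last by exists p, w.
    by exists p', w'; split=> //; apply/nesym.
  by left; adjusted sH [:: z; z'; x; y; l; v]
    [:: (0, 1, false); (2, 3, false); (4, 5, true)]. }
(* From here on, off-edges join only vertices of equal degree. *)
have off1 x y : degree H x = 1 -> linked G H false x y -> degree H y = 1.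
  move=> dx lxy; have [] := off_cases cubG sH dx lxy => -[? [? ?]] //;
    npairs_absurd.
have off2 x y : degree H x = 2 -> linked G H false x y -> degree H y = 2.
  move=> dx lxy; have [] := off_cases cubG sH dx lxy => -[? [? ?]] //;
    npairs_absurd.
case: (posnP (npairs G H true 1 1)) => [?|/npairs_gt0[x [b [dx db [? ? ? ?]]]]].
  2: {
  have [x' lxx'] := off_nbr cubG sH dx isT.
  have dx' := off1 _ _ dx lxx'; have [? ? ? ?] := lxx'.
  by left; adjusted sH [:: x; b; x'; z; z']
    [:: (0, 1, true); (0, 2, false); (3, 4, false)]. }
have on1 x y : degree H x = 1 -> linked G H true x y -> degree H y = 3.
  move=> dx lxy; have [] := on_cases cubG sH dx lxy => -[? [? ?]] //;
    npairs_absurd.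
case: (posnP (npairs G H true 2 2)) => [?|/npairs_gt0[y [x [dy dx [? ? ? ?]]]]].
  2: {
  have [y' lyy'] := off_nbr cubG sH dy isT.
  have dy' := off2 _ _ dy lyy'; have [? ? ? ?] := lyy'.
  by left; apply: up; adjusted sH [:: y; x; y'; p; w]
    [:: (0, 1, true); (0, 2, false); (3, 4, true)]. }
have on2 x y : degree H x = 2 -> linked G H true x y -> degree H y = 3.
  move=> dx lxy; have [] := on_cases cubG sH dx lxy => -[? [? ?]] //;
    npairs_absurd.
have m1 : 3 <= mdeg H 1.
  have [p2 ? lpp2] := off_other cubG sH p' dp isT.
  have dp2 := off1 _ _ dp lpp2; have [? ? ? ?] := lpp2.
  apply: (@mdeg_ge _ H [:: p; p'; p2] 1) => /=; last by rewrite dp dp' dp2.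
  by prove_distinct.
have /npairs_gt0[y [y' [dy dy' [? ? ? ?]]]] : 0 < npairs G H false 2 2 by count.
have [|unmixed] := boolP [exists w, exists l, exists y, [&& degree H w == 3,
    degree H l == 1, degree H y == 2, adj H w l & adj H w y]].
  case/existsP => v /existsP[l /existsP[u /and5P[/eqP dv /eqP dl /eqP du hvl hvu]]].
  have [? ? ? ?] : linked G H true v l by apply: linkedP; rewrite ?sH.
  have [? ? ? ?] : linked G H true v u by apply: linkedP; rewrite ?sH.
  have [u' luu'] := off_nbr cubG sH du isT.
  have du' := off2 _ _ du luu'; have [? ? ? ?] := luu'.
  have [p1 llp1] := off_nbr cubG sH dl isT.
  have dp1 := off1 _ _ dl llp1; have [? ? ? ?] := llp1.
  have [p2 ? l12] := off_other cubG sH l dp1 isT.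
  have dp2 := off1 _ _ dp1 l12; have [? ? ? ?] := l12.
  by left; adjusted sH [:: v; l; u; u'; p1; p2; z; z'] [:: (0, 1, true);
    (0, 2, true); (2, 3, false); (4, 5, false); (6, 7, false)].
have {}unmixed v l u : degree H v = 3 -> degree H l = 1 -> degree H u = 2 ->
    linked G H true v l -> linked G H true v u -> False.
  move=> dv dl du [_ _ hvl _] [_ _ hvu _]; case/negP: unmixed.
  by apply/existsP; exists v; apply/existsP; exists l; apply/existsP; exists u;
    rewrite dv dl du hvl hvu.
have [c2|c3] := leqP c 2; last first.
  have [|y2 + dy2] := @mdeg_avoid _ H [:: y; y'] 2; first by rewrite /=; count.
  rewrite !inE => /norP[/eqP ? /eqP ?].
  have [w2 lyw2] := on_nbr cubG sH dy2 isT.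
  have dw2 := on2 _ _ dy2 lyw2; have [? ? ? ?] := lyw2.
  have ? : w <> w2.
    move=> e; apply: (unmixed w p y2 dw dp dy2 (linked_sym lpw)).
    by rewrite e; apply: linked_sym.
  by left; apply: up; adjusted sH [:: y; y'; p; w; y2; w2]
    [:: (0, 1, false); (2, 3, true); (4, 5, true)].
(* [m1] gives [q >= 3], and [c2] gives [q <= 3]. *)
have q3 : q = 3 by count.
right; split; [by rewrite n q3 | | by right; apply: (attains_eq h); count].
have [w2 lyw2] := on_nbr cubG sH dy isT.
have [w3 ? lyw3] := on_other cubG sH w2 dy isT.
have dw2 := on2 _ _ dy lyw2; have dw3 := on2 _ _ dy lyw3.
have nw v : linked G H true y v -> degree H v = 3 -> v <> w.
  move=> lyv dv e; apply: (unmixed w p y dw dp dy (linked_sym lpw)).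
  by rewrite -e; apply: linked_sym.
have ? := nw _ lyw2 dw2; have ? := nw _ lyw3 dw3.
(* The vertices of degree 3 are [w], [w2], [w3]; the last two are joined to [y] of degree 2, so by
   [unmixed] to no vertex of degree 1. *)
have on_w x v : degree H x = 1 -> linked G H true x v -> v = w.
  move=> dx lxv; have dv := on1 _ _ dx lxv; apply/eqP/negPn/negP => /eqP vw.
  have ? : v <> w2.
    move=> e; apply: (unmixed v x y dv dx dy (linked_sym lxv)).
    by rewrite e; apply: linked_sym.
  have ? : v <> w3.
    move=> e; apply: (unmixed v x y dv dx dy (linked_sym lxv)).
    by rewrite e; apply: linked_sym.
  have := @mdeg_ge _ H [:: w; w2; w3; v] 3; rewrite /= dw dw2 dw3 dv.
  suff U : uniq [:: w; w2; w3; v] by move=> /(_ U erefl); count.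
  by prove_distinct.
have adj_w : [set v | adj G w v] = [set x | degree H x == 1].
  apply/esym/eqP; rewrite eqEcard (card_adj cubG) -/(mdeg H 1).
  apply/andP; split; last by count.
  apply/subsetP => x; rewrite !inE => /eqP dx.
  have [v lxv] := on_nbr cubG sH dx isT.
  by have [? ? ? ?] := lxv; rewrite -(on_w _ _ dx lxv) adj_sym.
(* The copies of [K_4] are degree 0, degree 1 with [w], and degree 2 with [w2] and [w3]. *)
apply: (@iso_three_closed T G cubG [set x | degree H x == 0]
         (w |: [set x | degree H x == 1])).
- by rewrite n q3.
- by rewrite -/(mdeg H 0); count.
- by rewrite cardsU1 -/(mdeg H 1) !inE dw /=; count.
- rewrite -setI_eq0; apply/eqP/setP => x; rewrite !inE.
  case: (eqVneq (degree H x) 0) => //= dx.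
  by rewrite dx orbF; apply/eqP; congruence.
- move=> x v gxv; rewrite !inE => /eqP dx.
  have [b lxv] : exists b, linked G H b x v by exists (adj H x v); apply: linkedP.
  case: b lxv => lxv.
    have := npairs_row cubG sH true 0.
    by have [] := on_cases cubG sH dx lxv => -[_ [+ _]]; count.
  by have [] := off_cases cubG sH dx lxv => -[? [? ?]]; apply/eqP => //;
    npairs_absurd.
move=> x v gxv; rewrite !inE => /orP[/eqP ex|/eqP dx].
  by move/setP/(_ v): adj_w; rewrite !inE -ex gxv => <-; rewrite orbT.
case hxv: (adj H x v).
  by rewrite (on_w _ _ dx (linkedP gxv hxv)) eqxx.
by rewrite (off1 _ _ dx (linkedP gxv hxv)) orbT.
Qed.

End UnitExcess.

(** * Descent of the two excesses to zero *)

Section Quadrant.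
Variables (T : finType) (G : sgraph T).
Hypothesis cubG : cubic G.

(* The even vertices number [i * 2] and the odd ones [j * 2]; [a] is half the
   excess of degree 0 over degree 2, and [c] that of degree 3 over degree 1. *)
Definition quadrant (i j a c : nat) : Prop :=
  exists b e, [/\ attains G (i + a) b e (j + c), b + c = j & e + a = i].

Lemma quadrant_of i j a c m0 m1 m2 m3 : attains G m0 m1 m2 m3 ->
  m0 = i + a -> m3 = j + c -> m1 + c = j -> m2 + a = i -> quadrant i j a c.
Proof. by move=> h e0 e3 e1 e2; exists m1, m2; rewrite -e0 -e3. Qed.

Lemma quadrant_compl i j a c : quadrant i j a c -> quadrant j i c a.
Proof.
by case=> b [e [h ? ?]]; exists e, b; split=> //; apply: attains_compl.
Qed.

Lemma mdeg_ge4 H k x : degree H x = k ->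
  (forall y, adj G x y -> degree H y = k) -> 4 <= mdeg H k.
Proof.
move=> dx nx; have <- : #|x |: [set y | adj G x y]| = 4.
  by rewrite cardsU1 (card_adj cubG) inE adj_irr.
apply/subset_leq_card/subsetP => y; rewrite !inE.
by case/orP => [/eqP->|/nx->]; rewrite ?dx.
Qed.

(* The vertices of degree 0 and those of degree 3 each form a union of
   components of [G]. When no flip helps, both classes and the rest have four
   vertices, so [G] is [3K_4]. *)
Lemma separated H q a c : spanning_subgraph H G -> #|T| = q * 4 ->
    mdeg H 0 = q + a -> mdeg H 3 = q + c ->
    mdeg H 1 + c = q -> mdeg H 2 + a = q ->
    0 < c <= a ->
    npairs G H false 0 1 = 0 -> npairs G H false 0 2 = 0 ->
    npairs G H true 1 3 = 0 -> npairs G H true 2 3 = 0 ->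
  three_K4 G \/ exists a' c', a' + c' < a + c /\ quadrant q q a' c'.
Proof.
move=> sH n E0 E3 E1 E2 /andP[c0 ca] n01 n02 n13 n23.
case: (npairs_eqs cubG sH) => -[? ? ?] [? ? ?] _.
have /npairs_gt0[z [z' [dz dz' [? ? ? ?]]]] : 0 < npairs G H false 0 0 by count.
have /npairs_gt0[w [w' [dw dw' [? ? ? ?]]]] : 0 < npairs G H true 3 3 by count.
have [c1|c2] := leqP c 1; last first.
  right; exists a.-2, c.-2; split; first by count.
  adjust sH [:: z; z'; w; w'] [:: (0, 1, false); (2, 3, true)] hs.
  by apply: (quadrant_of hs); clear_npairs; count.
have closed0 x y : degree H x = 0 -> adj G x y -> degree H y = 0.
  move=> dx gxy; case hxy: (adj H x y); have lxy := linkedP gxy hxy.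
    have := on_cases cubG sH erefl (linked_sym lxy); rewrite dx.
    by case=> -[].
  by have [] := off_cases cubG sH dx lxy => -[? [? ?]] //; npairs_absurd.
have closed3 x y : degree H x = 3 -> adj G x y -> degree H y = 3.
  move=> dx gxy; case hxy: (adj H x y); have lxy := linkedP gxy hxy.
    by have [] := on_cases cubG sH dx lxy => -[? [? ?]] //; npairs_absurd.
  have := off_cases cubG sH erefl (linked_sym lxy); rewrite dx.
  by case=> -[].
have m3 : 4 <= mdeg H 3 by apply: (mdeg_ge4 dw) => y; apply: closed3.
have /npairs_gt0[p [p' [dp dp' lpp']]] : 0 < npairs G H false 1 1 by count.
have [? ? ? ?] := lpp'.
have [|none] := boolP [exists x, exists x', [&& x \notin [:: p; p'],
    degree H x == 1, degree H x' == 1, adj G x x' & ~~ adj H x x']].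
  case/existsP => x /existsP[x' /and5P[]]; rewrite !inE => /norP[/eqP ? /eqP ?].
  move=> /eqP dx /eqP dx' gxx' /negPf hxx'.
  have [? ? ? ?] := linkedP gxx' hxx'.
  have [b lxb] := on_nbr cubG sH dx isT; have [? ? ? ?] := lxb.
  right; exists a.-1, c; split; first by count.
  have [[db _]|[db _]|[_ [? _]]] := on_cases cubG sH dx lxb; last by npairs_absurd.
    adjust sH [:: x; b; x'; z; z']
      [:: (0, 1, true); (0, 2, false); (3, 4, false)] hs.
    by apply: (quadrant_of hs); clear_npairs; count.
  adjust sH [:: z; z'; p; p'; x; b]
    [:: (0, 1, false); (2, 3, false); (4, 5, true)] hs.
  by apply: (quadrant_of hs); clear_npairs; count.
have n11 : npairs G H false 1 1 <= 2.
  rewrite npairs_split; have <- : #|[set (p, p'); (p', p)]| = 2.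
    by rewrite cards2 xpair_eqE; case: (eqVneq p p').
  apply/subset_leq_card/subsetP => -[x x']; rewrite !inE /=.
  case/and4P => dx dx' gxx' hxx'.
  have in2 u v : degree H u == 1 -> degree H v == 1 -> adj G u v ->
      ~~ adj H u v -> u \in [:: p; p'].
    move=> du dv guv huv; apply: contraNT none => nu.
    by apply/existsP; exists u; apply/existsP; exists v; rewrite nu du dv guv huv.
  have := in2 x x' dx dx' gxx'; rewrite (eqP hxx') => /(_ isT).
  have := in2 x' x dx' dx; rewrite adj_sym gxx' adj_sym (eqP hxx') => /(_ isT isT).
  have : x != x' by apply: contraTneq gxx' => ->; rewrite adj_irr.
  rewrite !inE !xpair_eqE => nxx' /orP[]/eqP e' /orP[]/eqP e;
    by rewrite e e' !eqxx ?orbT // in nxx' *.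
(* Off-edges at degree 1 give [q - 2 + a <= npairs G H false 1 1 <= 2], while [m3] gives
   [q >= 3]. *)
have [q3 a1 c1' m1] : [/\ q = 3, a = 1, c = 1 & mdeg H 1 = 2] by split; count.
left; split; first by rewrite n q3.
  apply: (@iso_three_closed T G cubG [set x | degree H x == 0]
           [set x | degree H x == 3]).
  - by rewrite n q3.
  - by rewrite -/(mdeg H 0); count.
  - by rewrite -/(mdeg H 3); count.
  - by rewrite -setI_eq0; apply/eqP/setP => x; rewrite !inE; case: eqP => // ->.
  - by move=> x y gxy; rewrite !inE => /eqP dx; rewrite (closed0 _ _ dx gxy).
  - by move=> x y gxy; rewrite !inE => /eqP dx; rewrite (closed3 _ _ dx gxy).
by left; exists H => //; split; count.
Qed.

Lemma quadrant_eq q a c : #|T| = q * 4 -> quadrant q q a c ->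
  attains G q q q q \/ three_K4 G.
Proof.
move=> n; have [k le] := ubnP (a + c); elim: k a c le => // k IH a c le hq.
have {}IH a' c' : a' + c' < a + c -> quadrant q q a' c' ->
    attains G q q q q \/ three_K4 G by move=> lt; apply: IH; lia.
wlog ca : a c le hq IH / c <= a.
  move=> base; have [|ac] := leqP c a; first exact: base.
  apply: (base c a); [lia|exact: quadrant_compl| |lia].
  by move=> a' c' lt; apply: IH; lia.
have [b [e [h bc ea]]] := hq.
have [H sH [E0 E1 E2 E3]] := h.
case: (npairs_eqs cubG sH) => -[? ? ?] [? ? ?] _.
case: (posnP a) => [a0|a0]; first by left; apply: (attains_eq h); count.
case: (posnP (npairs G H false 0 1)) => [?|/npairs_gt0[z [p [dz dp [? ? ? ?]]]]].
  2: { adjust sH [:: z; p] [:: (0, 1, false)] hs.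
  by apply: (IH a.-1 c); [count|apply: (quadrant_of hs); clear_npairs; count]. }
have /npairs_gt0[z [z' [dz dz' [? ? ? ?]]]] : 0 < npairs G H false 0 0 by count.
case: (posnP c) => [c0|c0].
  have [a1|a2] := leqP a 1.
    by apply: (@excess_one _ _ cubG q e) => //;
      [count|apply: (attains_eq h); count].
  have /npairs_gt0[p [p' [dp dp' [? ? ? ?]]]] : 0 < npairs G H false 1 1 by count.
  adjust sH [:: z; z'; p; p'] [:: (0, 1, false); (2, 3, false)] hs.
  by apply: (IH a.-2 c); [count|apply: (quadrant_of hs); clear_npairs; count].
case: (posnP (npairs G H true 2 3)) => [?|/npairs_gt0[y [w [dy dw [? ? ? ?]]]]].
  2: { adjust sH [:: y; w] [:: (0, 1, true)] hs.
  by apply: (IH a c.-1); [count|apply: (quadrant_of hs); clear_npairs; count]. }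
have /npairs_gt0[w [w' [dw dw' [? ? ? ?]]]] : 0 < npairs G H true 3 3 by count.
case: (posnP (npairs G H true 1 3)) => [?|/npairs_gt0[l [v [dl dv [? ? ? ?]]]]].
  2: { adjust sH [:: z; z'; l; v] [:: (0, 1, false); (2, 3, true)] hs.
  by apply: (IH a.-1 c.-1); [count|apply: (quadrant_of hs); clear_npairs; count]. }
case: (posnP (npairs G H false 0 2)) => [?|/npairs_gt0[u [y [du dy [? ? ? ?]]]]].
  2: { adjust sH [:: w; w'; u; y] [:: (0, 1, true); (2, 3, false)] hs.
  by apply: (IH a.-1 c.-1); [count|apply: (quadrant_of hs); clear_npairs; count]. }
have [|[a' [c' [lt hq']]]] :
    three_K4 G \/ exists a' c', a' + c' < a + c /\ quadrant q q a' c'.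
  by apply: (@separated H) => //; count.
  by right.
exact: IH lt hq'.
Qed.

End Quadrant.

(** * Orders congruent to two modulo four *)

Section QuadrantOdd.
Variables (T : finType) (G : sgraph T).
Hypothesis cubG : cubic G.

(** By complementation the counts [q, q.+1, q, q.+1] serve as well; with two targets no graph
    escapes. *)
Lemma excess_one_odd q : 0 < q ->
  attains G q.+2 q q q -> attains G q.+1 q q.+1 q.
Proof.
move=> q0 h; have [H sH [E0 E1 E2 E3]] := h.
case: (npairs_eqs cubG sH) => -[? ? ?] [? ? ?] _.
case: (posnP (npairs G H false 0 1)) => [?|/npairs_gt0[z [p [dz dp [? ? ? ?]]]]].
  2: by adjusted sH [:: z; p] [:: (0, 1, false)].
have /npairs_gt0[z [z' [dz dz' [? ? ? ?]]]] : 0 < npairs G H false 0 0 by count.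
case: (posnP (npairs G H false 1 2)) => [?|/npairs_gt0[x [y [dx dy [? ? ? ?]]]]].
  2: by apply: (attains_compl cubG);
       adjusted sH [:: z; z'; x; y] [:: (0, 1, false); (2, 3, false)].
have off1 x y : degree H x = 1 -> linked G H false x y -> degree H y = 1.
  move=> dx lxy; have [] := off_cases cubG sH dx lxy => -[? [? ?]] //;
    npairs_absurd.
case: (posnP (npairs G H true 1 2)) => [?|/npairs_gt0[x [y [dx dy [? ? ? ?]]]]].
  2: { have [p1 lxp1] := off_nbr cubG sH dx isT.
  have dp1 := off1 _ _ dx lxp1; have [? ? ? ?] := lxp1.
  have [p2 ? l12] := off_other cubG sH x dp1 isT.
  have dp2 := off1 _ _ dp1 l12; have [? ? ? ?] := l12.
  by adjusted sH [:: z; z'; p1; p2; x; y]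
    [:: (0, 1, false); (2, 3, false); (4, 5, true)]. }
have [p _ dp] : exists2 p, p \notin [::] & degree H p = 1.
  by apply: mdeg_avoid; rewrite E1.
have [p' lpp'] := off_nbr cubG sH dp isT.
have dp' := off1 _ _ dp lpp'; have [? ? ? ?] := lpp'.
have [w lpw] := on_nbr cubG sH dp isT; have [? ? ? ?] := lpw.
have [[dw _]|[_ [? _]]|[dw _]] := on_cases cubG sH dp lpw; [|by npairs_absurd|].
  by adjusted sH [:: p; w; p'; z; z']
    [:: (0, 1, true); (0, 2, false); (3, 4, false)].
case: (posnP (npairs G H false 0 2)) => [?|/npairs_gt0[u [y [du dy [? ? ? ?]]]]].
  2: by adjusted sH [:: p; w; p'; u; y]
       [:: (0, 1, true); (0, 2, false); (3, 4, false)].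
have /npairs_gt0[y [y' [dy dy' [? ? ? ?]]]] : 0 < npairs G H false 2 2 by count.
apply: (attains_compl cubG).
by adjusted sH [:: p; w; p'; y; y'; z; z']
  [:: (0, 1, true); (0, 2, false); (3, 4, false); (5, 6, false)].
Qed.

Lemma quadrant_odd_eq q a c : 0 < q -> quadrant G q.+1 q a c ->
  attains G q.+1 q q.+1 q.
Proof.
(* At [a = 0 < c], flipping a 0-2 off-edge and complementing leads to the excesses [c] and [0], with
   the same sum; the extra bit makes this a descent. *)
move=> q0; have [k le] := ubnP ((a + c) * 2 + ((a == 0) && (0 < c))).
elim: k a c le => // k IH a c le hq.
have {}IH a' c' :
    (a' + c') * 2 + ((a' == 0) && (0 < c')) < (a + c) * 2 + ((a == 0) && (0 < c)) ->
    quadrant G q.+1 q a' c' -> attains G q.+1 q q.+1 q by move=> lt; apply: IH; lia.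
have [b [e [h bc ea]]] := hq.
have [H sH [E0 E1 E2 E3]] := h.
case: (npairs_eqs cubG sH) => -[? ? ?] [? ? ?] _.
have [a0|a0] := posnP a.
  have [c0|c0] := posnP c; first by apply: (attains_eq h); count.
  case: (posnP (npairs G H true 2 3)) => [?|/npairs_gt0[y [w [dy dw [? ? ? ?]]]]].
    2: { adjust sH [:: y; w] [:: (0, 1, true)] hs.
    by apply: (IH 0 c.-1); [count|apply: (quadrant_of hs); clear_npairs; count]. }
  case: (posnP (npairs G H false 0 2)) => [?|/npairs_gt0[z [y [dz dy [? ? ? ?]]]]].
    2: { adjust sH [:: z; y] [:: (0, 1, false)] hs.
    apply: (IH c 0); first by count.
    by apply: (quadrant_of (attains_compl cubG hs)); clear_npairs; count. }
  have /npairs_gt0[x [y [dx dy lxy]]] : 0 < npairs G H true 2 2 by count.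
  have [? ? ? ?] := lxy.
  have down m0 m1 m2 m3 : attains G m0 m1 m2 m3 -> m0 = q -> m3 = q + c ->
      m2 = q -> attains G q.+1 q q.+1 q.
    move=> hm em0 em3 em2; have := attains_sum cubG hm.
    have := attains_sum cubG h => ? ?.
    apply: (IH c.-1 0); first by count.
    by apply: (quadrant_of (attains_compl cubG hm)); count.
  case: (posnP (npairs G H false 0 1)) => [?|/npairs_gt0[z [p [dz dp [? ? ? ?]]]]].
    2: { adjust sH [:: x; y; z; p] [:: (0, 1, true); (2, 3, false)] hs.
    by apply: (down _ _ _ _ hs); clear_npairs; count. }
  have /npairs_gt0[z [z' [dz dz' [? ? ? ?]]]] : 0 < npairs G H false 0 0 by count.
  case: (posnP (npairs G H true 1 2)) => [?|/npairs_gt0[l [u [dl du [? ? ? ?]]]]].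
    2: { adjust sH [:: z; z'; l; u] [:: (0, 1, false); (2, 3, true)] hs.
    by apply: (down _ _ _ _ hs); clear_npairs; count. }
  have on2 u v : degree H u = 2 -> linked G H true u v -> degree H v = 2.
    move=> du luv; have [] := on_cases cubG sH du luv => -[? [? ?]] //;
      npairs_absurd.
  have /npairs_gt0[w [w' [dw dw' [? ? ? ?]]]] : 0 < npairs G H true 3 3 by count.
  case: (posnP (npairs G H false 2 2)) => [?|/npairs_gt0[u [u' [du du' [? ? ? ?]]]]].
    2: { have [v luv] := on_nbr cubG sH du isT.
    have dv := on2 _ _ du luv; have [? ? ? ?] := luv.
    adjust sH [:: u; v; u'; w; w']
      [:: (0, 1, true); (0, 2, false); (3, 4, true)] hs.
    by apply: (IH 0 c.-1); [count|apply: (quadrant_of hs); clear_npairs; count]. }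
  have /npairs_gt0[p [u [dp du [? ? ? ?]]]] : 0 < npairs G H false 1 2 by count.
  have [v luv] := on_nbr cubG sH du isT.
  have dv := on2 _ _ du luv; have [? ? ? ?] := luv.
  have [v' ? lvv'] := on_other cubG sH u dv isT.
  have dv' := on2 _ _ dv lvv'; have [? ? ? ?] := lvv'.
  adjust sH [:: p; u; v; v'; w; w']
    [:: (0, 1, false); (2, 3, true); (4, 5, true)] hs.
  by apply: (IH 0 c.-1); [count|apply: (quadrant_of hs); clear_npairs; count].
case: (posnP (npairs G H false 0 1)) => [?|/npairs_gt0[z [p [dz dp [? ? ? ?]]]]].
  2: { adjust sH [:: z; p] [:: (0, 1, false)] hs.
  by apply: (IH a.-1 c); [count|apply: (quadrant_of hs); clear_npairs; count]. }
have /npairs_gt0[z [z' [dz dz' [? ? ? ?]]]] : 0 < npairs G H false 0 0 by count.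
have [c0|c0] := posnP c; last first.
  adjust sH [:: z; z'] [:: (0, 1, false)] hs.
  apply: (IH c.-1 a.-1); first by count.
  by apply: (quadrant_of (attains_compl cubG hs)); clear_npairs; count.
have [a1|a2] := leqP a 1.
  by apply: excess_one_odd => //; apply: (attains_eq h); count.
have /npairs_gt0[p [p' [dp dp' [? ? ? ?]]]] : 0 < npairs G H false 1 1 by count.
adjust sH [:: z; z'; p; p'] [:: (0, 1, false); (2, 3, false)] hs.
by apply: (IH a.-2 c); [count|apply: (quadrant_of hs); clear_npairs; count].
Qed.

End QuadrantOdd.

(** * Starting point and conclusion *)

(** Each edge is counted once, at its end of smaller rank, and the sum is doubled by exchanging the
    ends. *)
Lemma handshake (T : finType) (H : sgraph T) : ~~ odd (\sum_x degree H x).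
Proof.
pose low x y : nat := adj H x y && (enum_rank x < enum_rank y).
suff -> : \sum_x degree H x = (\sum_x \sum_y low x y).*2 by rewrite odd_double.
rewrite -addnn [X in _ + X]exchange_big -big_split; apply: eq_bigr => x _ /=.
rewrite /degree -sum_bool_card -big_split; apply: eq_bigr => y _ /=.
rewrite /low [adj H y x]adj_sym; case: ltngtP => [||/val_inj/enum_rank_inj <-];
  by rewrite ?adj_irr ?andbT ?andbF ?addn0.
Qed.

Section Conclusion.
Variables (T : finType) (G : sgraph T).
Hypothesis cubG : cubic G.

Lemma even_order : ~~ odd #|T|.
Proof.
have := handshake G; rewrite (eq_bigr (fun=> 3)) => [|x _]; last exact: cubG.
by rewrite sum_nat_const oddM andbT.
Qed.

Lemma attains_even a b c d : attains G a b c d -> ~~ odd (b + d).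
Proof.
case=> H sH [_ <- _ <-]; have := handshake H.
suff -> : \sum_x degree H x = mdeg H 1 + mdeg H 2 * 2 + mdeg H 3 * 3.
  by rewrite !oddD !oddM andbF andbT addbF.
rewrite /mdeg -!sum_bool_card !big_distrl -!big_split; apply: eq_bigr => x _ /=.
by have := degree_le3 cubG sH x; case: (degree H x) => [|[|[|[|]]]].
Qed.

Definition closed_nbhd (B : {set T}) : {set T} :=
  B :|: [set y | [exists x, (x \in B) && adj G x y]].

(* Growing [B] along an edge adds at most two vertices to its closed
   neighbourhood; when [B] is a union of components, a new vertex adds four, but
   then the neighbourhood is [B] itself. *)
Lemma small_nbhd k : k <= #|T| ->
  exists2 B : {set T}, #|B| = k & #|closed_nbhd B| <= k * 2 + 2.
Proof.
elim: k => [_|k IH lt].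
  exists set0; rewrite ?cards0 // /closed_nbhd set0U.
  by rewrite eq_card0 // => y; rewrite inE; apply/existsP => -[x]; rewrite inE.
have [|B cB cN] := IH; first exact: ltnW.
have grow v : closed_nbhd (v |: B) = closed_nbhd B :|: (v |: [set y | adj G v y]).
  apply/setP => y; rewrite !inE; apply/idP/idP.
    case/orP => [/orP[->|->]|/existsP[x]]; rewrite ?orbT // !inE.
    case/andP => /orP[/eqP->|xB] xy; rewrite ?xy ?orbT //.
    by apply/orP; left; apply/orP; right; apply/existsP; exists x; rewrite xB.
  case/orP => [/orP[->|/existsP[x /andP[xB xy]]]|/orP[->|vy]]; rewrite ?orbT //.
    by apply/orP; right; apply/existsP; exists x; rewrite !inE xB orbT.
  by apply/orP; right; apply/existsP; exists v; rewrite !inE eqxx.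
have card4 v : #|v |: [set y | adj G v y]| = 4.
  by rewrite cardsU1 (card_adj cubG) inE adj_irr.
have sub : B \subset closed_nbhd B by apply: subsetUl.
have [e|ne] := eqVneq B (closed_nbhd B).
  have [v vB] : exists v, v \notin B.
    apply/existsP; rewrite -negb_forall; apply/negP => /forallP all.
    have : #|B| = #|T| by rewrite -cardsT; apply: eq_card => v; rewrite inE all.
    lia.
  exists (v |: B); first by rewrite cardsU1 vB cB.
  by rewrite grow cardsU card4 -e cB; lia.
have /subsetPn[v vN vB] : ~~ (closed_nbhd B \subset B).
  by apply: contra ne => sub'; rewrite eqEsubset sub.
exists (v |: B); first by rewrite cardsU1 vB cB.
move: (vN); rewrite !inE (negPf vB) /= => /existsP[u /andP[uB uv]].
have : #|[set u; v]| <= #|closed_nbhd B :&: (v |: [set y | adj G v y])|.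
  apply/subset_leq_card/subsetP => y; rewrite in_setI => /set2P[]->.
    by rewrite (subsetP sub) // !inE adj_sym uv orbT.
  by rewrite vN !inE eqxx.
rewrite cards2 grow cardsU card4.
have -> : u != v by apply: contraNneq vB => <-.
lia.
Qed.

Lemma start_state k : k <= #|T| ->
  exists a b c d, [/\ attains G a b c d, k <= d & #|T| <= a + (k * 2 + 2)].
Proof.
move=> /small_nbhd[B cB cN].
pose r x y := adj G x y && ((x \in B) || (y \in B)).
have rs : symmetric r by move=> x y; rewrite /r adj_sym orbC.
have ri : irreflexive r by move=> x; rewrite /r adj_irr.
pose H := SGraph rs ri.
exists (mdeg H 0), (mdeg H 1), (mdeg H 2), (mdeg H 3); split.
- by exists H => // x y /andP[].
- rewrite -cB; apply/subset_leq_card/subsetP => x xB; rewrite inE -(cubG x).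
  by apply/eqP/eq_card => y; rewrite !inE /= /r xB andbT.
have := cardsC (closed_nbhd B).
suff : #|~: closed_nbhd B| <= mdeg H 0 by lia.
apply/subset_leq_card/subsetP => x; rewrite !inE => /norP[xB /existsPn none].
apply/eqP/eq_card0 => y; rewrite !inE /= /r (negPf xB) /=.
by have := none y; rewrite adj_sym andbC => /negPf.
Qed.

(** By [attains_even] the number [a + c] is even, so descending by two hits [i * 2] exactly. *)
Lemma reach_quadrant i j a b c d : attains G a b c d ->
    #|T| = (i + j) * 2 -> i <= j.+1 -> j <= i.+1 -> 0 < i ->
    i <= a -> j <= d -> i * 2 <= a + c ->
  (exists a' c', quadrant G i j a' c') \/ special G i j.
Proof.
move=> h n ij ji i0; have [k] := ubnP (a + c).
elim: k a b c d h => // k IH a b c d h le ia jd ie.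
have ev := attains_even h; have sum := attains_sum cubG h; rewrite n in sum.
have [e|ne] := eqVneq (a + c) (i * 2).
  by left; exists (a - i), (d - j); apply: (quadrant_of h); lia.
have [[a' [b' [c' [d' [h' ia' jd' e']]]]]|] :
    dominates G i j (a + c - 2) \/ special G i j.
- by apply: (lower_even cubG h) => //; lia.
- by apply: (IH _ _ _ _ h'); lia.
by right.
Qed.

(** Starting from [k = q] gives [m 0 >= 2q - 2], which is at least [q] because [q > 1].
    Complementing ensures that at least half of the vertices are even. *)
Lemma order_mod0 q : #|T| = q * 4 -> 1 < q -> attains G q q q q \/ three_K4 G.
Proof.
move=> n q1; have [|a [b [c [d [h kd na]]]]] := @start_state q; first lia.
have sum := attains_sum cubG h; rewrite n in sum na.
have [[a' [c' hq]]|[]] : (exists a' c', quadrant G q q a' c') \/ special G q q.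
- have [ge|lt] := leqP (q * 2) (a + c).
    by apply: (reach_quadrant h); lia.
  by apply: (reach_quadrant (attains_compl cubG h)); lia.
- exact: quadrant_eq hq.
lia.
Qed.

(** Now [m 0 >= 2q >= q + 1] at the start. As [special i j] demands [j = i.+1], it can occur only in
    the complemented branch. *)
Lemma order_mod2 q : #|T| = q * 4 + 2 -> 0 < q ->
  attains G q.+1 q q.+1 q \/
  [/\ q = 1, attains G 1 0 3 2 & isomorphic G (complete_bip 3 3)].
Proof.
move=> n q0; have [|a [b [c [d [h kd na]]]]] := @start_state q; first lia.
have sum := attains_sum cubG h; have ev := attains_even h; rewrite n in sum na.
have [ge|lt] := leqP (q.+1 * 2) (a + c).
  have [[a' [c' hq]]|[]] :
      (exists a' c', quadrant G q.+1 q a' c') \/ special G q.+1 q.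
  - by apply: (reach_quadrant h); lia.
  - by left; apply: quadrant_odd_eq hq.
  lia.
have [[a' [c' hq]]|[_ []]] :
    (exists a' c', quadrant G q q.+1 a' c') \/ special G q q.+1.
- by apply: (reach_quadrant (attains_compl cubG h)); lia.
- by left; apply: (quadrant_odd_eq cubG q0 (quadrant_compl cubG hq)).
- by left.
- move=> h'; left; apply: (@quadrant_odd_eq _ _ cubG q 0 1) => //.
  by apply: (quadrant_of h'); lia.
by right.
Qed.

(** Deviation at most [t / 4] without fractions: [t = 2] is one half, [t = 6] three halves. *)
Definition within t (H : sgraph T) : Prop :=
  forall k, k <= 3 -> mdeg H k * 4 <= #|T| + t /\ #|T| <= mdeg H k * 4 + t.

Lemma attains_within a b c d t : attains G a b c d ->
    (forall m, m \in [:: a; b; c; d] -> m * 4 <= #|T| + t /\ #|T| <= m * 4 + t) ->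
  exists2 H, spanning_subgraph H G & within t H.
Proof.
case=> H sH [E0 E1 E2 E3] near; exists H => // -[|[|[|[|//]]]] _;
  by rewrite ?E0 ?E1 ?E2 ?E3; apply: near; rewrite !inE eqxx ?orbT.
Qed.

Lemma near_balanced :
  (exists2 H, spanning_subgraph H G & within 2 H) \/
  (exceptional G /\ exists2 H, spanning_subgraph H G & within 6 H).
Proof.
have ev := even_order.
have [n0|/card_gt0P[x _]] := posnP #|T|.
  left; exists G => // k _; have : mdeg G k <= #|T| by apply: max_card.
  lia.
have n4 : 4 <= #|T|.
  rewrite -(_ : #|x |: [set y | adj G x y]| = 4) ?max_card //.
  by rewrite cardsU1 (card_adj cubG) inE adj_irr.
have [q [] n] : exists q, #|T| = q * 4 \/ #|T| = q * 4 + 2.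
  by exists (#|T| %/ 4); lia.
- have [q1|q1] := leqP q 1.
    have n_4 : #|T| = 4 by lia.
    right; split; first by constructor 1; apply: iso_complete.
    have sG : spanning_subgraph G G by [].
    (* The complement of [G] in itself is edgeless; adding one edge gives the counts 2, 2, 0, 0. *)
    have [|H sH [E0 _ _ _]] := @attains_compl T G cubG 0 0 0 4.
      exists G => //; rewrite /mdeg.
      split; try by apply: eq_card0 => y; rewrite inE cubG.
      by rewrite -n_4; apply: eq_card => y; rewrite inE cubG.
    case: (npairs_eqs cubG sH) => -[? ? ?] [? ? ?] ?.
    have /npairs_gt0[z [z' [dz dz' [? ? ? ?]]]] : 0 < npairs G H false 0 0 by count.
    adjust sH [:: z; z'] [:: (0, 1, false)] hs.
    apply: (attains_within hs) => m.
    by rewrite !inE => /or4P[]/eqP->; count.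
  have [h|[n12 iso [h|h]]] := order_mod0 n q1.
  + by left; apply: (attains_within h) => m; rewrite !inE => /or4P[]/eqP->; lia.
  + right; split; first by constructor 2.
    by apply: (attains_within h) => m; rewrite !inE => /or4P[]/eqP->; lia.
  right; split; first by constructor 2.
  by apply: (attains_within h) => m; rewrite !inE => /or4P[]/eqP->; lia.
have [|h|[q1 h iso]] := order_mod2 n; first lia.
  by left; apply: (attains_within h) => m; rewrite !inE => /or4P[]/eqP->; lia.
right; split; first by constructor 3.
by apply: (attains_within h) => m; rewrite !inE => /or4P[]/eqP->; lia.
Qed.

End Conclusion.

Import Order.TTheory GRing.Theory Num.Theory.
Local Open Scope ring_scope.

Lemma deviation_le (m n t : nat) : (m * 4 <= n + t)%N -> (n <= m * 4 + t)%N ->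
  `|m%:R - n%:R / 4%:R| <= t%:R / 4%:R :> rat.
Proof.
rewrite -!(ler_nat rat) !natrD !natrM => ? ?; rewrite ler_norml; lra.
Qed.

Theorem corollary3p1 (T : finType) (G : sgraph T) (n : nat)
    (hn : #|T| = n) (hG : cubic G) :
  (~ exceptional G ->
     exists2 H : sgraph T, spanning_subgraph H G &
       forall k : nat, (k <= 3)%N ->
         `|(mdeg H k)%:R - n%:R / 4%:R| <= 1 / 2%:R :> rat)
  /\
  (exceptional G ->
     exists2 H : sgraph T, spanning_subgraph H G &
       \big[Num.max/0]_(0 <= k < 4) `|(mdeg H k)%:R - n%:R / 4%:R|
         <= 3%:R / 2%:R :> rat).
Proof.
have bound t (H : sgraph T) k : within t H -> (k <= 3)%N ->
    `|(mdeg H k)%:R - n%:R / 4%:R| <= t%:R / 4%:R :> rat.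
  by rewrite -hn => wt /wt[lo hi]; exact: deviation_le lo hi.
split=> [nexc|_].
  have [[H sH w2]|[//]] := near_balanced hG.
  exists H => // k k3; apply: le_trans (bound _ _ _ w2 k3) _; lra.
have [H sH w6] : exists2 H, spanning_subgraph H G & within 6 H.
  have [[H sH w2]|[_ //]] := near_balanced hG.
  by exists H => // k /w2[]; lia.
exists H => //; rewrite big_mkord; apply/bigmax_leP; split; first lra.
move=> k _; apply: le_trans (bound _ _ k w6 _) _; last lra.
by rewrite -ltnS.
Qed.
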